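(* Let $n$ be a cube-free positive integer. Then there do not exist finite groups $G$ and $N$, both of order $n$, such that $G$ is insolvable, $N$ is solvable, and $\mathcal{E}'(G,N)$ is non-empty.
   Context: For a finite group $N$, let $\mathrm{Perm}(N)$ be the group of all permutations of the set $N$. A subgroup $\mathcal{G}\le \mathrm{Perm}(N)$ is regular if the map $\mathcal{G}\to N$, $\sigma\mapsto\sigma(1_N)$, is bijective. Let $\rho:N\to\mathrm{Perm}(N)$, $\rho(\eta)(x)=x\eta^{-1}$. The holomorph of $N$ is $\mathrm{Hol}(N)=\rho(N)\rtimes\mathrm{Aut}(N)\le\mathrm{Perm}(N)$. For a group $G$ with $|G|=|N|$, $\mathcal{E}'(G,N)$ denotes the set of regular subgroups of $\mathrm{Hol}(N)$ isomorphic to $G$. *)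

(* Defs.v *)
From mathcomp Require Import all_boot all_fingroup all_solvable.
Set Implicit Arguments. Unset Strict Implicit. Unset Printing Implicit Defensive.
Local Open Scope group_scope.

(* A finite group N is modelled as the full group [set: nT] of a finGroupType nT;
   Perm(N) is {perm nT}. *)

Lemma rho_inj (nT : finGroupType) (eta : nT) : injective (fun x : nT => x * eta^-1).
Proof. by move=> x y; apply: mulIg. Qed.

Definition rho (nT : finGroupType) (eta : nT) : {perm nT} := perm (@rho_inj nT eta).

Definition Hol (nT : finGroupType) : {set {perm nT}} :=
  ([set rho eta | eta : nT] * Aut [set: nT])%g.

Definition regular (nT : finGroupType) (H : {set {perm nT}}) : Prop :=
  {in H &, injective (fun s : {perm nT} => s 1)} /\
  (forall x : nT, exists2 s, s \in H & s 1 = x).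

Definition in_E' (gT nT : finGroupType) (H : {group {perm nT}}) : Prop :=
  [/\ H \subset Hol nT, regular H & H \isog [set: gT]].

Arguments in_E' gT nT H : clear implicits.

Definition cube_free (n : nat) : Prop := forall p, prime p -> ~~ (p ^ 3 %| n).

(* Main.v *)
Require Import Defs.
From mathcomp Require Import all_boot all_fingroup all_solvable.
From mathcomp Require Import all_algebra mxrepresentation mxabelem.
Set Implicit Arguments. Unset Strict Implicit. Unset Printing Implicit Defensive.
Import GRing.Theory.
Local Open Scope group_scope.

(* If G is insolvable, so is the regular subgroup of Hol(N) isomorphic to it,
   which then contains a perfect subgroup P <> 1. Any perfect group of cube-free
   order normalising a solvable group of cube-free order centralises it: by
   induction along a chief series this reduces to an elementary abelian group of
   rank at most 2, hence to showing that SL_2(p) has no perfect subgroup X <> 1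
   of cube-free order. By transfer, a Sylow subgroup of X for the smallest prime
   divisor of #|X| is not central in its normaliser; since it has order q or q^2,
   this forces q = 2, order 4, and several involutions. But SL_2(p) has a
   single involution -1 for p odd, and #|SL_2(2)| = 6.
   So P centralises rho(N), hence consists of left translations of N, and it
   is solvable: a contradiction. *)

(** * Perfect groups of cube-free order: fusion, transfer, involutions *)

Lemma cube_free_dvd (m n : nat) : m %| n -> cube_free n -> cube_free m.
Proof.
by move=> dv cf p /cf; apply: contra => /dvdn_trans; apply.
Qed.

(** Burnside's argument: [Q] and [Q :^ x] are both Sylow in the centraliser of [u ^ x]; if [y] there
    carries the second to the first, then [x * y] normalises [Q] and so fixes [u]. *)
Lemma abelian_Sylow_fusion (gT : finGroupType) (p : nat) (G Q : {group gT})
    (u x : gT) :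
  p.-Sylow(G) Q -> abelian Q -> 'N_G(Q) \subset 'C(Q) ->
  x \in G -> u \in Q -> u ^ x \in Q -> u ^ x = u.
Proof.
move=> sylQ abQ cNQ Gx Qu Qux; have [sQG pQ _] := and3P sylQ.
have sCG: 'C_G[u ^ x] \subset G := subsetIl _ _.
have sylQ1: p.-Sylow('C_G[u ^ x]) Q.
  apply: pHall_subl sylQ => //; rewrite subsetI sQG /=.
  by apply: subset_trans abQ _; rewrite -cent_set1 centS // sub1set.
have sylQ2: p.-Sylow('C_G[u ^ x]) (Q :^ x).
  have sylQx: p.-Sylow(G) (Q :^ x)%G by rewrite pHallJ.
  apply: pHall_subl sylQx => //; rewrite subsetI conj_subG //=.
  rewrite -cent_set1 -conjg_set1 centJ conjSg cent_set1.
  by apply: subset_trans abQ _; rewrite -cent_set1 centS // sub1set.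
have [y /setIP[Gy /cent1P cy] /= defQ] := Sylow_trans sylQ2 sylQ1.
have Nxy: x * y \in 'N_G(Q).
  by rewrite inE groupM // inE conjsgM /= -defQ.
have : u ^ (x * y) = u by rewrite conjgE -(centP (subsetP cNQ _ Nxy) _ Qu) mulKg.
by rewrite conjgM conjgE -cy mulKg.
Qed.

(* The transfer of [g \in Q] into [Q] is [g ^+ #|G : Q|], because the factors
   of its cycle expansion are conjugates of powers of [g] lying in [Q]. *)
Lemma perfect_abelian_Sylow_eq1 (gT : finGroupType) (p : nat) (G Q : {group gT}) :
  G \subset G^`(1) -> p.-Sylow(G) Q -> abelian Q -> 'N_G(Q) \subset 'C(Q) ->
  Q :=: 1.
Proof.
move=> perfG sylQ abQ cNQ; have [sQG pQ p'GQ] := and3P sylQ.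
pose alpha := idm_morphism Q.
have abA: abelian (alpha @* Q) by rewrite /= morphim_idm.
pose tr := [morphism of transfer G abA].
(* The transfer has an abelian target, so it kills the derived subgroup, hence [G]. *)
have ker_tr: G \subset 'ker tr.
  apply: subset_trans perfG _; apply: der1_min; first exact: ker_norm.
  rewrite (isog_abelian (first_isog tr)) /=.
  apply/centsP=> x _ y _; exact: (GRing.addrC (x : FiniteModule.fmod_of abA)).
apply/trivgP/subsetP=> g Qg; have Gg := subsetP sQG g Qg.
pose X := transversal (rcosets Q G :* <[g]>) G.
have trX : is_transversal X (rcosets Q G :* <[g]>) G.
  exact/transversalP/rcosets_cycle_partition.
have XG x : x \in X -> x \in G by apply/subsetP/(transversal_sub trX).
have pw x : x \in X -> (g ^+ #|<[g]> : Q :* x|) ^ x^-1 = g ^+ #|<[g]> : Q :* x|.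
  move=> Xx; apply: abelian_Sylow_fusion sylQ abQ cNQ _ _ _;
    rewrite ?groupV ?XG ?groupX //.
  by rewrite conjgE invgK mulgA -mem_rcoset mulg_exp_card_rcosets.
have tr0 := transfer_cycle_expansion sQG abA Gg trX.
have {tr0} gGQ: g ^+ #|G : Q| = 1.
  rewrite (mker (f := tr) (subsetP ker_tr g Gg)) in tr0.
  move/(congr1 (@FiniteModule.fmval _ _ _)): tr0.
  rewrite FiniteModule.fmval_sum => /esym /= tr0.
  rewrite -(sum_index_rcosets_cycle sQG Gg trX) -[RHS]tr0.
  rewrite -[LHS]/(expgn g _) (big_morph (expgn g) (id1 := 1) (op1 := mulg)) //.
    apply: eq_bigr => x Xx; rewrite pw //= FiniteModule.fmodK //= morphim_idm //.
    exact: groupX.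
  exact: expgD.
have pg: p.-nat #[g] by apply: mem_p_elt pQ Qg.
have dvg: #[g] %| #|G : Q| by rewrite order_dvdn gGQ.
apply/set1P/eqP; rewrite -order_eq1; apply/eqP.
exact: pnat_1 pg (pnat_dvd dvg p'GQ).
Qed.

(* [#|Q| - #|'C_Q(R)|] is one of q - 1, q^2 - q and q^2 - 1, and the prime r > q
   can only divide the last one, as r = q + 1. *)
Lemma noncentral_action_card_p2 (gT : finGroupType) (q r : nat) (R Q : {group gT}) :
  prime q -> prime r -> q < r -> r.-group R -> R \subset 'N(Q) ->
  #|Q| %| q ^ 2 -> ~~ (R \subset 'C(Q)) -> 
  [/\ q = 2, #|Q| = 4 & 'C_Q(R) = 1].
Proof.
move=> q_pr r_pr ltqr rR nQR oQ ncQR.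
have q_gt1 := prime_gt1 q_pr; have q_gt0 := prime_gt0 q_pr.
have fixQ: #|Q| = #|'C_Q(R)| %[mod r].
  by rewrite -afixJ; apply: pgroup_fix_mod => //; rewrite astabsJ.
have ltC: #|'C_Q(R)| < #|Q|.
  apply: proper_card; rewrite properE subsetIl subsetI subxx /=.
  by rewrite centsC.
have /(dvdn_pfactor _ _ q_pr)[k lek2 oQk] := oQ.
have /(dvdn_pfactor _ _ q_pr)[j lej2 oCj] :=
  dvdn_trans (cardSg (subsetIl Q 'C(R))) oQ.
have rdv: r %| #|Q| - #|'C_Q(R)| by rewrite -eqn_mod_dvd ?(ltnW ltC) //; apply/eqP.
have ndv d : 0 < d -> d <= q -> ~~ (r %| d).
  by move=> d0 dq; rewrite gtnNdvd // (leq_ltn_trans dq).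
move: ltC rdv; rewrite oQk oCj ltn_exp2l // => ltjk.
case: k j oQk ltjk lek2 oCj {lej2} => [|[|[|k]]] // [|[|j]] // oQk _ _ oCj.
- by rewrite expn0 expn1 (negPf (ndv _ _ _)) ?subn_gt0 ?leq_subr.
- rewrite (subn_sqr q 1) Euclid_dvdM // (negPf (ndv _ _ _)) ?subn_gt0 ?leq_subr //=.
  rewrite addn1 => /dvdn_leq-/(_ isT) leqr.
  have def_r: r = q.+1 by apply/eqP; rewrite eqn_leq leqr.
  have q2: q = 2.
    have [// | odd_q] := even_prime q_pr.
    have [r2 | ] := even_prime r_pr; first by rewrite r2 ltnS leqNgt q_gt1 in ltqr.
    by rewrite def_r /= odd_q.
  by rewrite q2; split=> //; apply: card1_trivg.
- have -> : (q ^ 2 - q ^ 1 = q * (q - 1))%N by rewrite mulnBr muln1 mulnn.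
  rewrite Euclid_dvdM //.
  by rewrite !(negPf (ndv _ _ _)) ?subn_gt0 ?leq_subr.
Qed.

(* Take a Sylow subgroup for the smallest prime divisor of [#|G|]; the second
   involution is a conjugate of the first under its normaliser. *)
Lemma perfect_cube_free_involutions (gT : finGroupType) (G : {group gT}) :
  G \subset G^`(1) -> cube_free #|G| -> G :!=: 1 ->
  4 %| #|G| /\ (exists x y, [/\ x \in G, y \in G, #[x] = 2, #[y] = 2 & x != y]).
Proof.
move=> perfG cfG ntG; set q := pdiv #|G|.
have G_gt1: 1 < #|G| by rewrite cardG_gt1.
have q_pr: prime q := pdiv_prime G_gt1.
have [Q sylQ] := Sylow_exists q G; have [sQG qQ _] := and3P sylQ.
have oQ : #|Q| %| q ^ 2.
  have /p_natP[k oQ] := qQ; rewrite oQ dvdn_exp2l //.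
  rewrite leqNgt; apply/negP=> lt2k; case/negP: (cfG q q_pr).
  by apply: dvdn_trans (cardSg sQG); rewrite oQ dvdn_exp2l.
have abQ : abelian Q.
  have /(dvdn_pfactor _ _ q_pr)[k lek2 oQk] := oQ.
  by rewrite (p2group_abelian qQ) // oQk pfactorK.
have ntQ: Q :!=: 1.
  by rewrite -cardG_gt1 (card_Hall sylQ) p_part_gt1 pi_pdiv.
have: ~~ ('N_G(Q) \subset 'C(Q)).
  apply: contra ntQ => cNQ; apply/eqP.
  exact: perfect_abelian_Sylow_eq1 perfG sylQ abQ cNQ.
(* The normaliser is generated by its Sylow subgroups, so one of them fails to centralise [Q]. *)
rewrite -{1}(Sylow_gen 'N_G(Q)) gen_subG => /bigcupsP ncN.
have [R sylR ncR]: exists2 R : {group gT}, Sylow 'N_G(Q) R & ~~ (R \subset 'C(Q)).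
  have [[R /andP[]]|nR] := altP (@existsP _
    (fun R : {group gT} => Sylow 'N_G(Q) R && ~~ (R \subset 'C(Q)))); first by exists R.
  case: ncN => R sylR; apply: contraR nR => ncR; apply/existsP; exists R.
  by rewrite sylR.
have [r r_pr sylrR] := SylowP _ _ sylR; have [sRN rR _] := and3P sylrR.
have [sRG nQR] := subsetIP sRN.
have ntR: R :!=: 1 by apply: contra ncR => /eqP->; rewrite sub1G.
(* If [r] were [q], then [R] would lie in [Q], which is abelian and Sylow in its normaliser. *)
have ltqr: q < r.
  rewrite ltn_neqAle; apply/andP; split.
    apply: contra ncR => /eqP eqr; apply: subset_trans abQ.
    have sylQN: q.-Sylow('N_G(Q)) Q.
      by apply: pHall_subl sylQ; rewrite ?subsetIl // subsetI sQG normG.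
    by rewrite (sub_normal_Hall sylQN) ?normalSG // eqr.
  apply: pdiv_min_dvd (prime_gt1 r_pr) (dvdn_trans _ (cardSg sRG)).
  by case/pgroup_pdiv: rR.
have [q2 oQ4 CQR1] := noncentral_action_card_p2 q_pr r_pr ltqr rR nQR oQ ncR.
split; first by rewrite -oQ4 cardSg.
have [x Qx ox]: {x | x \in Q & #[x] = q}.
  by apply: Cauchy => //; have [] := pgroup_pdiv qQ ntQ.
have [y Ry ncxy]: exists2 y, y \in R & x ^ y != x.
  apply/exists_inP; apply: contraTT (prime_gt1 q_pr) => /exists_inPn fixx.
  rewrite -ox -leqNgt leq_eqVlt order_eq1 -in_set1 -[[set 1]]CQR1 inE Qx.
  apply/orP; left; apply/centP=> y Ry; apply/commgP/conjg_fixP/eqP.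
  by have:= fixx y Ry; rewrite negbK.
exists x, (x ^ y).
by rewrite groupJ ?(subsetP sQG x) ?(subsetP sRG y) // orderJ ox -q2 eq_sym.
Qed.

(** * Perfect matrix groups of degree at most 2 *)

Lemma perfect_det_repr (F : fieldType) (gT : finGroupType) (G : {group gT}) (n : nat)
    (rG : mx_representation F G n) (x : gT) :
  G \subset G^`(1) -> x \in G -> (\det (rG x) = 1)%R.
Proof.
(* The kernel [K] of the determinant contains all commutators. *)
move=> perfG Gx; pose K := [set y in G | (\det (rG y) == 1)%R].
have gK : group_set K.
  apply/group_setP; split=> [|y z]; first by rewrite inE group1 repr_mx1 det1 eqxx.
  rewrite !inE => /andP[Gy /eqP dy] /andP[Gz /eqP dz].
  by rewrite groupM //= repr_mxM // det_mulmx dy dz mulr1.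
have detV y : y \in G -> (\det (rG y^-1%g) * \det (rG y) = 1)%R.
  by move=> Gy; rewrite -det_mulmx -repr_mxM ?groupV // mulVg repr_mx1 det1.
suff /subsetP/(_ x Gx) : G \subset group gK by rewrite inE Gx => /eqP.
apply: subset_trans perfG _; rewrite gen_subG; apply/subsetP=> _ /imset2P[y z Gy Gz ->].
rewrite inE groupR //= commgEl conjgE !repr_mxM ?groupM ?groupV // !det_mulmx.
by rewrite mulrCA [(\det (rG y) * _)%R]mulrC mulrA mulrACA !detV // mulr1.
Qed.

(** In degree 2, the off-diagonal entries of [A *m A] are those of [A] times its trace. Trace 0
    would give determinant -1; otherwise [A] is diagonal, and determinant 1 makes it scalar. *)
Lemma det1_involution_mx (F : fieldType) (n : nat) (A : 'M[F]_n) :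
  n <= 2 -> (2%:R != 0 :> F)%R -> (\det A = 1)%R -> (A *m A = 1%:M)%R ->
  (A = 1%:M \/ A = (- 1)%:M)%R.
Proof.
case: n A => [|[|[|n]]] // A _ nz2 detA sqA.
- by left; apply/matrixP=> - [].
- by left; rewrite [LHS]mx11_scalar -det_mx11 detA.
have l01 : lift ord0 ord0 = 1%R :> 'I_2 by apply: val_inj.
have l10 : lift 1%R ord0 = 0%R :> 'I_2 by apply: val_inj.
have entry i j : (A i 0 * A 0 j + A i 1 * A 1 j = (i == j)%:R)%R.
  have := congr1 (fun B : 'M_2 => B i j) sqA.
  by rewrite !mxE !big_ord_recl big_ord0 l01 addr0.
have {}detA : (A 0 0 * A 1 1 - A 0 1 * A 1 0 = 1)%R.
  move: detA; rewrite (expand_det_row _ ord0) !big_ord_recl big_ord0 l01 /cofactor.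
  by rewrite !det_mx11 !mxE /= addr0 expr0 expr1 mul1r mulN1r mulrN l10 l01.
have [trA0 | trAn0] := eqVneq (A 0 0 + A 1 1)%R 0%R.
  rewrite -(addr0_eq trA0) mulrN -opprD (entry 0%R 0%R) /= in detA.
  by case/eqP: nz2; rewrite mulr2n -{1}detA addNr.
have A01 : (A 0 1 = 0)%R.
  apply: (mulIf trAn0); rewrite mul0r mulrDr mulrC.
  exact: (entry 0%R 1%R).
have A10 : (A 1 0 = 0)%R.
  apply: (mulIf trAn0); rewrite mul0r mulrDr [(_ * A 1 1)%R]mulrC.
  exact: (entry 1%R 0%R).
have sqA00 : (A 0 0 * A 0 0 = 1)%R by have := entry 0%R 0%R; rewrite A01 mul0r addr0.
have A11 : (A 1 1 = A 0 0)%R.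
  by rewrite A01 mul0r subr0 in detA; rewrite -[LHS]mul1r -sqA00 -mulrA detA mulr1.
have defA : (A = (A 0 0)%:M)%R.
  have I2 (k : 'I_2) : k = 0%R \/ k = 1%R.
    by case: k => [[|[|k]] ltk] //; [left | right]; apply: val_inj.
  apply/matrixP=> i j; rewrite !mxE.
  by case: (I2 i) => ->; case: (I2 j) => ->; rewrite ?A01 ?A10 ?A11.
have : (A 0 0 == 1)%R || (A 0 0 == - 1)%R by rewrite -sqrf_eq1 expr2 sqA00.
by case/orP=> /eqP A00; rewrite defA A00; [left | right].
Qed.

Lemma perfect_cube_free_mx_faithful (p : nat) (gT : finGroupType) (G : {group gT})
    (n : nat) (rG : mx_representation 'F_p G n) :
  prime p -> n <= 2 -> G \subset G^`(1) -> cube_free #|G| -> mx_faithful rG -> G :=: 1.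
Proof.
move=> p_pr le_n2 perfG cfG ffG; apply/eqP; apply: contraT => ntG.
have [dv4 [x [y [Gx Gy ox oy]]]] := perfect_cube_free_involutions perfG cfG ntG.
have sq z : z \in G -> #[z] = 2 -> (rG z *m rG z = 1%:M)%R.
  by move=> Gz oz; rewrite -repr_mxM // -expg2 -oz expg_order repr_mx1.
have inj := mx_faithful_inj ffG.
have [p2 | odd_p] := even_prime p_pr.
  subst p; case: n rG ffG le_n2 inj {sq} => [|n] rG ffG le_n2 inj.
    case/eqP: ntG; apply/trivgP/subsetP=> z Gz; apply/set1P.
    by apply: inj => //; apply/matrixP=> - [].
  have: #|G| %| #|'GL_n.+1(2)|.
    have injG : 'injm (reprGLm rG) by rewrite ker_reprGLm.
    by rewrite -(card_injm injG (subxx G)) cardSg // subsetT.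
  (* The exponent of 2 in the order of GL_d(2) is d(d-1)/2, at most 1 for d <= 2. *)
  move/(dvdn_trans dv4)/(dvdn_leq_log 2 (cardG_gt0 _)).
  rewrite logn_card_GL_p //; case: n {rG ffG inj} le_n2 => [|[|n]] //.
have nz2 : (2%:R != 0 :> 'F_p)%R.
  rewrite -(dvdn_pcharf (pchar_Fp p_pr)); apply/negP=> /(dvdn_leq (ltn0Sn _)).
  by move: odd_p (prime_gt1 p_pr); case: p {rG ffG sq inj p_pr} => [|[|[]]].
have inv z : z \in G -> #[z] = 2 -> rG z = ((- 1)%:M)%R.
  move=> Gz oz; case: (det1_involution_mx le_n2 nz2 _ (sq z Gz oz)) => //.
    exact: perfect_det_repr.
  rewrite -(repr_mx1 rG) => /inj -/(_ Gz (group1 _)) z1.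
  by rewrite z1 order1 in oz.
by case/eqP; apply: inj; rewrite // !inv.
Qed.

(** * Perfect groups acting on solvable groups *)

Lemma perfect_cube_free_cent_abelem (p : nat) (gT : finGroupType) (G M : {group gT}) :
  prime p -> p.-abelem M -> #|M| %| p ^ 2 -> G \subset G^`(1) -> cube_free #|G| ->
  G \subset 'N(M) -> G \subset 'C(M).
Proof.
move=> p_pr abelM oM perfG cfG nMG.
have [-> | ntM] := eqVneq M 1%G; first by rewrite cent1T subsetT.
(* Modulo its centraliser, [G] acts faithfully on [M] as an ['F_p]-space of dimension at most 2. *)
pose rG := abelem_repr abelM ntM nMG.
have defC : rker rG = 'C_G(M) := rker_abelem abelM ntM nMG.
suff : G / rker rG == 1 by rewrite -subG1 quotient_sub1 ?rker_norm //= defC subsetI => /andP[].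
apply/eqP; apply: (perfect_cube_free_mx_faithful p_pr _ _ _ (kquo_mx_faithful rG)).
- rewrite (dim_abelemE abelM ntM); have := dvdn_leq_log p _ oM.
  by rewrite pfactorK // => -> //; rewrite expn_gt0 prime_gt0.
- by rewrite /= -quotient_der ?rker_norm // quotientS.
exact: cube_free_dvd (dvdn_quotient _ _) cfG.
Qed.

(* With [M] a minimal normal subgroup of [N <*> G] inside [N], the perfect
   group [G] centralises [M] and [N / M], hence [N] by three subgroups. *)
Lemma perfect_cube_free_cent_solvable (gT : finGroupType) (G N : {group gT}) :
  solvable N -> cube_free #|N| -> G \subset G^`(1) -> cube_free #|G| ->
  G \subset 'N(N) -> G \subset 'C(N).
Proof.
have [m] := ubnP #|N|; elim: m gT G N => // m IHm gT G N leNm solN cfN perfG cfG nNG.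
have [-> | ntN] := eqVneq N 1%G; first by rewrite cent1T subsetT.
have nsN : N <| N <*> G by rewrite normalYl.
have [M [sMN nsM ntM abM]] := solvable_norm_abelem solN nsN ntN.
have [nMN nMG] : N \subset 'N(M) /\ G \subset 'N(M).
  by apply/andP; rewrite -join_subG normal_norm.
have /is_abelemP[p p_pr abelM] := abM.
have cMG : G \subset 'C(M).
  apply: (perfect_cube_free_cent_abelem p_pr abelM) => //.
  have /p_natP[k oM] := abelem_pgroup abelM; rewrite oM dvdn_exp2l //.
  rewrite leqNgt; apply/negP=> lt2k; case/negP: (cfN p p_pr).
  by apply: dvdn_trans (cardSg sMN); rewrite oM dvdn_exp2l.
have cNMG : G / M \subset 'C(N / M).
  apply: IHm; rewrite ?quotient_sol ?quotient_norms //.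
  - exact: leq_trans (ltn_quotient ntM sMN) leNm.
  - exact: cube_free_dvd (dvdn_quotient _ _) cfN.
  - by rewrite -quotient_der // quotientS.
  - exact: cube_free_dvd (dvdn_quotient _ _) cfG.
rewrite quotient_cents2 // in cNMG.
have GNG1 : [~: G, N, G] :=: 1.
  by apply/commG1P; rewrite centsC; apply: subset_trans cMG (centS cNMG).
have NGG1 : [~: N, G, G] :=: 1 by rewrite (commGC N G).
(* As [G] lies in [[~: G, G]], it suffices that [[~: G, G, N]] is trivial. *)
apply: subset_trans perfG _; apply/commG1P.
exact: three_subgroup GNG1 NGG1.
Qed.

(** * Translations and the holomorph *)

Lemma rho_morph (nT : finGroupType) :
  {in [set: nT] &, {morph (fun x : nT => rho x^-1) : x y / x * y}}.
(* Permutations compose from left to right, so [rho] itself reverses products; the inverse corrects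
   this. *)
Proof. by move=> x y _ _; apply/permP=> z; rewrite permM !permE !invgK mulgA. Qed.

Canonical rho_morphism (nT : finGroupType) := Morphism (@rho_morph nT).

Lemma rho_image (nT : finGroupType) :
  [set rho eta | eta : nT] = rho_morphism nT @* [set: nT].
Proof.
apply/setP=> s; apply/imsetP/morphimP => [[x _ ->] | [x _ _ ->]].
  by exists x^-1; rewrite ?inE //= invgK.
by exists x^-1.
Qed.

Lemma Hol_sub_norm_rho (nT : finGroupType) :
  Hol nT \subset 'N(rho_morphism nT @* [set: nT]).
Proof.
rewrite /Hol rho_image mul_subG ?normG //; apply/subsetP=> a Aut_a.
rewrite inE; apply/subsetP=> _ /imsetP[_ /morphimP[x _ _ ->] ->].
(* Conjugation by [a] turns right translation by [x] into that by [a x]. *)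
apply/morphimP; exists (a x); rewrite ?inE //; apply/permP=> z /=.
rewrite conjgE !permM ![rho _ _]permE !invgK -{2}(permKV a z).
by rewrite (morphicP (Aut_morphic Aut_a)) ?inE.
Qed.

(* A permutation commuting with all right translations is the left translation
   by its value at [1]. *)
Lemma cent_rho_solvable (nT : finGroupType) (P : {group {perm nT}}) :
  solvable [set: nT] -> P \subset 'C(rho_morphism nT @* [set: nT]) -> solvable P.
Proof.
move=> solN cP.
have trP s x : s \in P -> s x = s 1 * x.
  move=> Ps; have /centP/(_ (rho x^-1)) := subsetP cP s Ps.
  rewrite (mem_morphim (rho_morphism nT)) ?inE // => /(_ isT) /permP/(_ 1).
  by rewrite !permM !permE !invgK mul1g.
(* Evaluation at 1 reverses products, hence the inverse. *)
have fM : {in P &, {morph (fun s : {perm nT} => (s 1)^-1) : s t / s * t}}.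
  by move=> s t Ps Pt; rewrite permM (trP t) // invMg.
have injf : 'injm (Morphism fM).
  apply/injmP=> s t Ps Pt /= /invg_inj s1t1.
  by apply/permP=> x; rewrite trP // s1t1 -trP.
rewrite -(injm_sol injf) //; exact: solvableS (subsetT _) solN.
Qed.

Theorem theorem1p6 (n : nat) : 0 < n -> cube_free n ->
  ~ (exists (gT nT : finGroupType),
       [/\ #|gT| = n, #|nT| = n, ~~ solvable [set: gT], solvable [set: nT] &
           exists H : {group {perm nT}}, in_E' gT nT H]).
Proof.
move=> _ cfn [gT [nT [oG oN nsolG solN [H [sHHol _ isoH]]]]].
pose R := (rho_morphism nT @* [set: nT])%G.
(* By definition, [solvable] says that every perfect subgroup is trivial; this is used for [H] here
   and for [P] itself at the end. *)
case/negP: nsolG; rewrite -(isog_sol isoH); apply/forall_inP=> P.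
rewrite subsetI => /andP[sPH perfP].
have cfP : cube_free #|P|.
  by apply: cube_free_dvd cfn; rewrite -oG -cardsT -(card_isog isoH) cardSg.
have cfR : cube_free #|R|.
  by apply: cube_free_dvd cfn; rewrite -oN -cardsT dvdn_morphim.
have nRP : P \subset 'N(R).
  exact: subset_trans sPH (subset_trans sHHol (Hol_sub_norm_rho nT)).
have cRP : P \subset 'C(R).
  exact: perfect_cube_free_cent_solvable (morphim_sol _ solN) cfR perfP cfP nRP.
have /forall_inP/(_ P) := cent_rho_solvable solN cRP.
by rewrite subsetI subxx => /(_ perfP).
Qed.
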